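(* Let $I$ be a totally ordered set, let $X=\{x_i\}_{i\in I}$, and let $\mathfrak{aar}(X)$ be the free antiassociative anti-right-commutative algebra over $\mathbb{C}$ generated by $X$. Then the set of elements $$\{x_i : i\in I\}\ \cup\ \{x_ix_j : i,j\in I\}\ \cup\ \{x_i(x_{j_1}x_{j_2}) : i,j_1,j_2\in I,\ j_1<j_2\}$$ is a basis of the vector space $\mathfrak{aar}(X)$ (elements with distinct indices listed above being distinct).
   Context: An algebra means a complex vector space with a bilinear multiplication, not assumed associative or unital. An algebra is antiassociative if $(xy)z=-x(yz)$ for all $x,y,z$, and anti-right-commutative if $(xy)z=-(xz)y$ for all $x,y,z$. The free antiassociative anti-right-commutative algebra generated by $X$ is the free object on $X$ in the variety of (non-unital) algebras defined by these two identities. *)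

(* Defs.v *)
From HB Require Import structures.
From mathcomp Require Export all_boot all_order all_algebra.
From mathcomp Require Export sesquilinear complex.
From mathcomp Require Export boolp classical_sets reals.

Set Implicit Arguments.
Unset Strict Implicit.
Unset Printing Implicit Defensive.

Export Order.TTheory GRing.Theory Num.Theory.
Global Open Scope classical_set_scope.
Global Open Scope ring_scope.

Section LinearBasis.
Variables (K : fieldType) (V : lmodType K).

(* The basis notions of vector.v are restricted to finite dimension; these are
   the usual ones for an arbitrary set of vectors. *)
Definition linearly_independent (B : set V) : Prop :=
  forall (s : seq V) (c : V -> K), uniq s -> (forall v, v \in s -> B v) ->
    \sum_(v <- s) c v *: v = 0 -> forall v, v \in s -> c v = 0.

Definition spanning (B : set V) : Prop :=
  forall u : V, exists (s : seq V) (c : V -> K),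
    (forall v, v \in s -> B v) /\ u = \sum_(v <- s) c v *: v.

Definition is_basis (B : set V) : Prop := linearly_independent B /\ spanning B.

End LinearBasis.

(* A (nonassociative, nonunital) K-algebra is a pair of a vector space A and a
   bilinear map mul : A -> A -> A. *)
Section AarAlgebras.
Variable K : fieldType.

Definition antiassociative (A : lmodType K) (mul : {bilinear A -> A -> A}) :=
  forall x y z : A, mul (mul x y) z = - mul x (mul y z).

Definition anti_right_commutative (A : lmodType K)
    (mul : {bilinear A -> A -> A}) :=
  forall x y z : A, mul (mul x y) z = - mul (mul x z) y.

Definition is_aar (A : lmodType K) (mul : {bilinear A -> A -> A}) : Prop :=
  antiassociative mul /\ anti_right_commutative mul.

Definition is_alg_hom (A B : lmodType K) (mulA : {bilinear A -> A -> A})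
    (mulB : {bilinear B -> B -> B}) (f : {linear A -> B}) : Prop :=
  forall u v : A, f (mulA u v) = mulB (f u) (f v).

(* (A, mul) with x : I -> A is a free object on I in the variety of
   antiassociative anti-right-commutative algebras. Uniqueness of the extension
   is stated pointwise. *)
Definition is_free_aar (I : Type) (A : lmodType K)
    (mul : {bilinear A -> A -> A}) (x : I -> A) : Prop :=
  is_aar mul /\
  forall (B : lmodType K) (mulB : {bilinear B -> B -> B}) (y : I -> B),
    is_aar mulB ->
    (exists f : {linear A -> B},
       is_alg_hom mul mulB f /\ forall i, f (x i) = y i) /\
    (forall f g : {linear A -> B},
       is_alg_hom mul mulB f -> (forall i, f (x i) = y i) ->
       is_alg_hom mul mulB g -> (forall i, g (x i) = y i) ->
       forall u, f u = g u).

End AarAlgebras.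

Section Monomials.
Context {disp : Order.disp_t} (I : orderType disp).

Definition aar_index : Type :=
  (I + I * I + I * {j : I * I | (j.1 < j.2)%O})%type.

Definition aar_monomial (K : fieldType) (A : lmodType K)
    (mul : {bilinear A -> A -> A}) (x : I -> A) (w : aar_index) : A :=
  match w with
  | inl (inl i) => x i
  | inl (inr (i, j)) => mul (x i) (x j)
  | inr (i, j) => mul (x i) (mul (x (val j).1) (x (val j).2))
  end.

End Monomials.

(* Main.v *)
Require Import Defs.
From HB Require Import structures.
From mathcomp Require Import functions ring.

Set Implicit Arguments.
Unset Strict Implicit.
Unset Printing Implicit Defensive.

(** Antiassociativity and anti-right-commutativity together give
    x(yz) = -(xy)z = (xz)y = -x(zy): a product x(yz) is alternating in y, z.
    Rebracketing abcd around the pentagon gives a(b(cd)) = -a(b(cd)), so every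
    product of four factors vanishes outside characteristic 2.

    Spanning.  By these identities the span of the listed monomials is closed
    under multiplication ([aar_span_mul_closed]).  A subalgebra of a free
    algebra that contains the generators is the whole algebra: freeness
    retracts the algebra onto it, and the retraction followed by the inclusion
    is the identity because both fix the generators ([free_aar_generated]).

    Independence.  The functions on the index set of the monomials carry an
    explicit multiplication that satisfies both identities
    ([aar_coord_aar]).  In this model the monomials evaluate to the indicator
    functions ([aar_monomial_delta]), so the homomorphism from the free algebra
    to the model provides a dual family for the monomials.  Hence they are
    distinct and independent.  Arbitrary functions are allowed, without finite
    support, since each coordinate of a product depends on finitely many
    coordinates of its factors. *)

(** * Spans and dual families *)

Section LinearSpan.
Variables (K : fieldType) (V : lmodType K) (B : set V).

(** Repetitions in the list of vectors are allowed, each occurrence with its own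
    scalar, so that sums of combinations are concatenations of lists. *)
Definition lin_span : {pred V} := fun u =>
  `[< exists2 t : seq (K * V), (forall p, p \in t -> B p.2) &
      u = \sum_(p <- t) p.1 *: p.2 >].

Lemma lin_spanP u :
  reflect (exists2 t : seq (K * V), (forall p, p \in t -> B p.2) &
             u = \sum_(p <- t) p.1 *: p.2)
          (u \in lin_span).
Proof. exact: asboolP. Qed.

Lemma lin_span_sub v : B v -> v \in lin_span.
Proof.
move=> Bv; apply/lin_spanP; exists [:: (1, v)].
  by move=> p; rewrite inE => /eqP ->.
by rewrite big_seq1 scale1r.
Qed.

Lemma lin_span_submod_closed : submod_closed lin_span.
Proof.
split=> [|a _ _ /lin_spanP[s Bs ->] /lin_spanP[t Bt ->]].
  by apply/lin_spanP; exists [::]; rewrite ?big_nil.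
apply/lin_spanP; exists ([seq (a * p.1, p.2) | p <- s] ++ t).
  move=> p; rewrite mem_cat => /orP[/mapP[q sq ->]|]; last exact: Bt.
  exact: Bs q sq.
rewrite big_cat big_map scaler_sumr; congr (_ + _).
by apply: eq_bigr => p _; rewrite scalerA.
Qed.

HB.instance Definition _ :=
  GRing.isSubmodClosed.Build K V lin_span lin_span_submod_closed.

(** In [spanning] the coefficient is a function of the vector, so the scalars
    attached to the occurrences of one vector have to be added up. *)
Lemma lin_span_spanning : (forall u, u \in lin_span) -> spanning B.
Proof.
move=> spanT u; have /lin_spanP[t Bt ->] := spanT u.
exists (undup [seq p.2 | p <- t]), (fun v => \sum_(p <- t | p.2 == v) p.1).
split=> [v|]; first by rewrite mem_undup => /mapP[p /Bt Bp ->].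
under [RHS]eq_bigr => v _ do rewrite scaler_suml big_mkcond.
rewrite exchange_big /=; apply: eq_big_seq => p tp.
rewrite -big_mkcond /= -big_filter.
rewrite (eq_filter (a2 := pred1 p.2)); last by move=> v; rewrite /= eq_sym.
rewrite filter_pred1_uniq ?undup_uniq ?big_seq1 //.
by rewrite mem_undup; apply: map_f.
Qed.

Lemma dual_family_independent :
  (forall v, B v -> exists2 f : {scalar V}, f v = 1 &
     forall u, B u -> u != v -> f u = 0) ->
  linearly_independent B.
Proof.
move=> dualB s c s_uniq sB sum0 v vs; have [f fv f0] := dualB v (sB v vs).
have := congr1 f sum0; rewrite linear_sum linear0 (bigD1_seq v) //= linearZ /=.
rewrite fv mulr1 big_seq_cond big1 ?addr0 // => u /andP[us uv].
by rewrite linearZ /= f0 ?mulr0 //; apply: sB.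
Qed.

End LinearSpan.

(** * Subalgebras of free algebras *)

Section Subalgebra.
Variables (K : fieldType) (A : lmodType K) (mul : {bilinear A -> A -> A}).
Variables (S : submodClosed A).
Hypothesis mulS : forall u v, u \in S -> v \in S -> mul u v \in S.

Definition subalg : Type := {u : A | u \in S}.

HB.instance Definition _ := SubChoice.on subalg.
HB.instance Definition _ := [SubChoice_isSubLmodule of subalg by <:].

Definition subalg_mul (u v : subalg) : subalg :=
  Sub (mul (val u) (val v)) (mulS (valP u) (valP v)).

Lemma subalg_mul_bilinear :
  bilinear_for (GRing.Scale.Law.clone _ _ *:%R _)
    (GRing.Scale.Law.clone _ _ *:%R _) subalg_mul.
Proof.
split=> u a v w; apply: val_inj; rewrite linearP /=.
  by rewrite linearPl.
by rewrite linearPr.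
Qed.

HB.instance Definition _ := bilinear_isBilinear.Build K
  subalg subalg subalg _ _ subalg_mul subalg_mul_bilinear.

Lemma subalg_aar : is_aar mul -> is_aar subalg_mul.
Proof.
by move=> [aA aC]; split=> u v w; apply: val_inj; rewrite linearN /=;
  [rewrite aA | rewrite aC].
Qed.

(** The retraction onto the subalgebra [S] given by freeness, followed by the
    inclusion, is an endomorphism that fixes the generators, hence the identity;
    so every element lies in [S]. *)
Lemma free_aar_generated (I : Type) (x : I -> A) :
  is_free_aar mul x -> (forall i, x i \in S) -> forall u, u \in S.
Proof.
move=> [aarA freeA] Sx u.
have [[f [fM fx]] _] :=
  freeA subalg subalg_mul (fun i => Sub (x i) (Sx i)) (subalg_aar aarA).
have [_ uniqA] := freeA A mul x aarA.
rewrite -[u]/(idfun u) -(uniqA (val \o f) idfun) /=.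
- exact: valP.
- by move=> v w; rewrite /= fM.
- by move=> i; rewrite /= fx.
- by move=> v w.
- by [].
Qed.

End Subalgebra.

(** * Consequences of the two identities *)

Section AarIdentities.
Variables (K : fieldType) (A : lmodType K) (mul : {bilinear A -> A -> A}).
Hypotheses (two_neq0 : 2%:R != 0 :> K) (aarA : is_aar mul).
Local Notation "u ** v" := (mul u v) (at level 40, left associativity).

Lemma eq_opp0 (u : A) : u = - u -> u = 0.
Proof.
move=> uN; apply/eqP; have: 2%:R *: u = 0.
  by rewrite scaler_nat mulr2n {2}uN subrr.
by move/eqP; rewrite scaler_eq0 (negPf two_neq0).
Qed.

(** Both identities rewrite (ab)c, into -a(bc) and into -(ac)b = a(cb). *)
Lemma aar_anticomm a b c : a ** (b ** c) = - (a ** (c ** b)).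
Proof.
by case: aarA => aA aC; rewrite -[LHS]opprK -aA aC opprK aA.
Qed.

Lemma aar_mulxx a b : a ** (b ** b) = 0.
Proof. exact/eq_opp0/aar_anticomm. Qed.

(** The two ways to rebracket ((ab)c)d into a(b(cd)) give opposite signs: the one
    through (ab)(cd) takes two steps, the one through (a(bc))d takes three. *)
Lemma aar_nil_comb a b c d : a ** (b ** (c ** d)) = 0.
Proof.
case: aarA => aA _; apply: eq_opp0.
have: a ** b ** c ** d = a ** (b ** (c ** d)) by rewrite !aA opprK.
by rewrite [a ** b ** c]aA linearNl aA opprK aA linearNr => ->.
Qed.

Lemma aar_nil_bal a b c d : a ** b ** (c ** d) = 0.
Proof. by case: aarA => aA _; rewrite aA aar_nil_comb oppr0. Qed.

Lemma aar_nil_left a b c d : a ** (b ** c) ** d = 0.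
Proof.
by case: aarA => aA _; rewrite aA aA linearNr aar_nil_comb !oppr0.
Qed.

Section MonomialSpan.
Context {disp : Order.disp_t} (I : orderType disp) (x : I -> A).
Local Notation S := (lin_span (range (aar_monomial mul x))).

Lemma aar_monomial_in_span w : aar_monomial mul x w \in S.
Proof. by apply: lin_span_sub; exists w. Qed.

Lemma aar_cubic_in_span i j k : x i ** (x j ** x k) \in S.
Proof.
case: (ltgtP j k) => [jk|kj|->]; last by rewrite aar_mulxx rpred0.
  exact: (aar_monomial_in_span (inr (i, Sub (j, k) jk))).
rewrite aar_anticomm rpredN.
exact: (aar_monomial_in_span (inr (i, Sub (k, j) kj))).
Qed.

Lemma aar_monomial_mul_in_span w w' :
  aar_monomial mul x w ** aar_monomial mul x w' \in S.
Proof.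
case: w w' => [[i|[i j]]|[i jk]] [[i'|[i' j']]|[i' jk']] /=;
  rewrite ?aar_nil_left ?aar_nil_comb ?aar_nil_bal ?rpred0 //.
- exact: (aar_monomial_in_span (inl (inr (i, i')))).
- exact: aar_cubic_in_span.
- by case: aarA => aA _; rewrite aA rpredN aar_cubic_in_span.
Qed.

(** On two monomials, a product has degree 2 and is listed, or degree 3 and is
    up to sign some x_i(x_jx_k), or degree at least 4 and vanishes; bilinearity
    extends this to the span. *)
Lemma aar_span_mul_closed u v : u \in S -> v \in S -> u ** v \in S.
Proof.
move=> /lin_spanP[s Bs ->] /lin_spanP[t Bt ->].
rewrite linear_sumlz big_seq; apply: rpred_sum => p /Bs[w _ <-].
rewrite linear_sumr big_seq; apply: rpred_sum => q /Bt[w' _ <-].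
by rewrite linearZl_LR linearZr_LR /= !rpredZ ?aar_monomial_mul_in_span.
Qed.

End MonomialSpan.
End AarIdentities.

(** * The coordinate model *)

Section CoordinateModel.
Variable K : fieldType.
Context {disp : Order.disp_t} (I : orderType disp).

Definition aar_coord : Type := aar_index I -> K.

HB.instance Definition _ := GRing.Lmodule.copy aar_coord (aar_index I -> K^o).

(** The coordinate at x_i(x_jx_k) collects x_i times the alternating part of the
    degree 2 component of [g], and the products (x_ix_j)x_k = -x_i(x_jx_k)
    and (x_ix_k)x_j = x_i(x_jx_k). *)
Definition aar_coord_mul (f g : aar_coord) : aar_coord := fun w =>
  match w with
  | inl (inl _) => 0
  | inl (inr (i, j)) => f (inl (inl i)) * g (inl (inl j))
  | inr (i, jk) =>
      let: (j, k) := val jk in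
      f (inl (inl i)) * (g (inl (inr (j, k))) - g (inl (inr (k, j))))
      - (f (inl (inr (i, j))) * g (inl (inl k))
         - f (inl (inr (i, k))) * g (inl (inl j)))
  end.

Lemma aar_coordPE a (f g : aar_coord) w : (a *: f + g) w = a * f w + g w.
Proof. by []. Qed.

Lemma aar_coordNE (f : aar_coord) w : (- f) w = - f w.
Proof. by []. Qed.

Definition aar_coef w (f : aar_coord) : K := f w.

HB.instance Definition _ w := GRing.isLinear.Build K aar_coord K *%R
  (aar_coef w) (fun a f g => aar_coordPE a f g w).

Lemma aar_coord_mul_bilinear :
  bilinear_for (GRing.Scale.Law.clone _ _ *:%R _)
    (GRing.Scale.Law.clone _ _ *:%R _) aar_coord_mul.
Proof.
by split=> h a f g; apply/funext => -[[i|[i j]]|[i [[j k] jk]]];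
  rewrite aar_coordPE /aar_coord_mul /= ?(aar_coordPE a f g); ring.
Qed.

HB.instance Definition _ := bilinear_isBilinear.Build K
  aar_coord aar_coord aar_coord _ _ aar_coord_mul aar_coord_mul_bilinear.

Lemma aar_coord_aar : is_aar aar_coord_mul.
Proof.
by split=> f g h; apply/funext => -[[i|[i j]]|[i [[j k] jk]]];
  rewrite aar_coordNE /= /aar_coord_mul /=; ring.
Qed.

(** The type annotation unfolds [aar_index], exposing the decidable equality of
    sum types. *)
Definition aar_delta (w : aar_index I) : aar_coord :=
  fun w' => ((w' : I + I * I + I * {j : I * I | (j.1 < j.2)%O}) == w)%:R.

Lemma aar_monomial_delta w :
  aar_monomial aar_coord_mul (fun i => aar_delta (inl (inl i))) w
  = aar_delta w.
Proof.
have mulb (p q : bool) : p%:R * q%:R = (p && q)%:R :> K.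
  by rewrite -natrM mulnb.
apply/funext.
case: w => [[i|[i j]]|[i [[j k] /= jk]]] -[[a|[a b]]|[a [[b c] /= bc]]] //=;
  rewrite /aar_delta /eq_op /= ?(mul0r, mulr0, subr0) //.
(* b < c and j < k, so (b, c) cannot be (k, j): the transposed term of the
   alternating part vanishes *)
rewrite !mulb.
have /negPf-> : ~~ ((c == j) && (b == k)).
  by apply/negP => /andP[/eqP cj /eqP bk]; rewrite cj bk lt_gtF in bc.
by rewrite subr0 mulb.
Qed.

End CoordinateModel.

Theorem proposition8 (R : realType) (disp : Order.disp_t) (I : orderType disp)
    (A : lmodType R[i]) (mul : {bilinear A -> A -> A}) (x : I -> A)
    (A_free : is_free_aar mul x) :
  is_basis (range (aar_monomial mul x)) /\ injective (aar_monomial mul x).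
Proof.
have two_neq0 : 2%:R != 0 :> R[i] by rewrite pnatr_eq0.
have aarA : is_aar mul := A_free.1.
pose delta : aar_index I -> aar_coord R[i] I := @aar_delta R[i] disp I.
have [[psi [psiM psix]] _] :=
  A_free.2 (aar_coord R[i] I) (@aar_coord_mul R[i] disp I)
    (fun i => delta (inl (inl i))) (aar_coord_aar _ _).
have psi_mono w : psi (aar_monomial mul x w) = delta w.
  rewrite /delta -aar_monomial_delta.
  by case: w => [[i|[i j]]|[i [[j k] jk]]]; rewrite /= ?psiM !psix.
have delta_inj : injective delta.
  move=> v w /(congr1 (fun f => f v)); rewrite /delta /aar_delta eqxx.
  by case: eqP => // _ /eqP; rewrite oner_eq0.
have mono_inj : injective (aar_monomial mul x).
  by move=> v w /(congr1 psi); rewrite !psi_mono => /delta_inj.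
split=> //; split.
- apply: dual_family_independent => _ [w _ <-].
  exists (aar_coef w \o psi : {scalar A}) => [|_ [w' _ <-]] /=;
    rewrite psi_mono /aar_coef /delta /aar_delta ?eqxx // (inj_eq mono_inj).
  by rewrite eq_sym => /negPf ->.
- apply: lin_span_spanning.
  apply: (free_aar_generated (aar_span_mul_closed two_neq0 aarA (x := x)) A_free).
  by move=> i; exact: (aar_monomial_in_span _ _ (inl (inl i))).
Qed.
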